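(* For every integer $d\geq 1$, \[ K(\mathcal{A}_d) \geq \frac{1}{\sqrt{d}+2}. \] Moreover, for every integer $d \geq 1$, $K(\mathcal{A}_d)$ is greater than or equal to the root $r>0$ of the equation \[ \sum_{k=1}^{\infty} r^k \binom{d+k-2}{k-1}^{1/2} = \frac12 . \]
   Context: $\mathbb{D}^d=\{z=(z_1,\dots,z_d)\in\mathbb{C}^d: |z_1|,\dots,|z_d|<1\}$ is the open unit polydisk. The Schur class $\mathcal{S}_d$ is the set of all analytic $f:\mathbb{D}^d\to\overline{\mathbb{D}}$, where $\overline{\mathbb D}$ is the closed unit disk. The (Schur-)Agler class $\mathcal{A}_d$ is the set of all $f\in\mathcal{S}_d$ such that $\|f(T_1,\dots,T_d)\|\leq 1$ (operator norm) for all $d$-tuples $T=(T_1,\dots,T_d)$ of pairwise commuting strictly contractive operators ($\|T_j\|<1$) on a common complex Hilbert space; here, if $f(z)=\sum_{\alpha\in\mathbb{N}^d} f_\alpha z^\alpha$, then $f(T)=\sum_\alpha f_\alpha T^\alpha$, with $T^\alpha=T_1^{\alpha_1}\cdots T_d^{\alpha_d}$ and $\mathbb{N}$ including $0$. For $f(z)=\sum_\alpha f_\alpha z^\alpha$ set $\|f\|_1=\sum_\alpha|f_\alpha|$, and for $0<r<1$ set $f_r(z)=f(rz)$. The Bohr-Agler radius is $K(\mathcal{A}_d)=\sup\{r\in(0,1): \|f_r\|_1\leq 1 \text{ for all } f\in\mathcal{A}_d\}$. *)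

(* Defs.v *)
From HB Require Import structures.
From mathcomp Require Import all_boot all_order all_algebra finmap.
From mathcomp Require Import sesquilinear complex.
From mathcomp Require Import all_classical all_reals all_analysis.
From mathcomp.analysis.showcase Require Import summability.
Set Implicit Arguments.
Unset Strict Implicit.
Unset Printing Implicit Defensive.
Import Order.TTheory GRing.Theory Num.Theory.
Import numFieldNormedType.Exports.
Local Open Scope classical_set_scope.
Local Open Scope ring_scope.

(* The topology of the complex numbers R[i] is carried by the alias R[i]^o.
   Norms over R[i] take values in R[i]; they are real, and `cnorm` reads them
   in R. *)

Section Norms.
Variable R : realType.

Definition cnorm (V : normedModType R[i]) (x : V) : R := complex.Re `|x|.

(* Unconditional convergence: the limit is along the finite subsets of I
   ordered by inclusion. *)
Definition has_sum (I : choiceType) (V : normedModType R[i])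
    (u : I -> V) (s : V) : Prop :=
  partial_sum u @ totally --> s.

Definition opnorm (H : normedModType R[i]) (T : H -> H) : \bar R :=
  ereal_sup [set (cnorm (T x))%:E | x in [set x | cnorm x <= 1]].

Definition hilbert (H : completeNormedModType R[i]) : Prop :=
  exists ip : {dot H for Num.conj}, forall x : H, `|x| ^+ 2 = ip x x.

End Norms.

Section PowerSeries.
Variables (R : realType) (d : nat).
Local Notation C := (R[i]^o).
Local Notation multiindex := {ffun 'I_d -> nat}.
Implicit Types (f : 'rV[C]_d -> C) (a : multiindex -> C).

Definition polydisk : set 'rV[C]_d := [set z | forall j, cnorm (z 0 j) < 1].

Definition monomial (z : 'rV[C]_d) (al : multiindex) : C :=
  \prod_(j < d) z 0 j ^+ al j.

Definition analytic_on (D : set 'rV[C]_d) f : Prop :=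
  forall p, D p -> exists a,
    \forall z \near p, has_sum (fun al => a al * monomial (z - p) al) (f z).

Definition expansion f a : Prop :=
  forall z, polydisk z -> has_sum (fun al => a al * monomial z al) (f z).

(* The coefficients f_al of f(z) = sum_al f_al z^al on the polydisk. Such an
   expansion exists and is unique if f is analytic there; the default value 0
   is used for the other functions only. *)
Definition coef f : multiindex -> C := xget (fun=> 0) (expansion f).

Definition norm1 f : \bar R := \esum_(al in [set: multiindex]) (cnorm (coef f al))%:E.

Definition dilate (r : R) f : 'rV[C]_d -> C := fun z => f (real_complex R r *: z).

End PowerSeries.

Section Agler.
Variables (R : realType) (d : nat).
Local Notation C := (R[i]^o).
Local Notation multiindex := {ffun 'I_d -> nat}.

(* Functions are total on C^d; only their values on the polydisk matter. *)
Definition schur_class (f : 'rV[C]_d -> C) : Prop :=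
  analytic_on (@polydisk R d) f /\
  forall z, polydisk z -> cnorm (f z) <= 1.

Definition oppow (H : normedModType R[i]) (T : 'I_d -> {linear H -> H})
    (al : multiindex) : H -> H :=
  \big[comp/idfun]_(j < d) iter (al j) (T j).

(* S = f(T): if f(z) = sum_al f_al z^al then f(T) = sum_al f_al T^al, the sum
   converging in operator norm. *)
Definition is_calculus (H : normedModType R[i]) (f : 'rV[C]_d -> C)
    (T : 'I_d -> {linear H -> H}) (S : {linear H -> H}) : Prop :=
  expansion f (coef f) /\
  (fun A : {fset multiindex} =>
     opnorm (fun x => S x - \sum_(al <- A) coef f al *: oppow T al x))
    @ totally --> 0%E.

(* For f in the Schur class and strict contractions T, f(T) always exists and
   is unique, so "exists S, is_calculus f T S /\ ..." means "f(T) is ...". *)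
Definition agler_class (f : 'rV[C]_d -> C) : Prop :=
  schur_class f /\
  forall H : completeNormedModType R[i], hilbert H ->
  forall T : 'I_d -> {linear H -> H},
    (forall i j x, T i (T j x) = T j (T i x)) ->
    (forall j, (opnorm (T j) < 1)%E) ->
  exists S : {linear H -> H}, is_calculus f T S /\ (opnorm S <= 1)%E.

Definition bohr_agler_radius : R :=
  sup [set r : R | 0 < r < 1 /\
    forall f, agler_class f -> (norm1 (dilate r f) <= 1)%E].

End Agler.

(* Main.v *)
Require Import Defs.
From HB Require Import structures.
From mathcomp Require Import all_boot all_order all_algebra finmap.
From mathcomp Require Import sesquilinear complex.
From mathcomp Require Import all_classical all_reals all_analysis.
From mathcomp Require Import ring lra zify.
From mathcomp.analysis.showcase Require Import summability.
Import Order.TTheory GRing.Theory Num.Theory.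
Import numFieldNormedType.Exports.
Local Open Scope classical_set_scope.
Local Open Scope ring_scope.
Set Implicit Arguments.
Unset Strict Implicit.
Unset Printing Implicit Defensive.

(** The bound comes from evaluating an Agler class function f, with
    coefficients f_al, at one well chosen tuple of commuting contractions for
    each degree k >= 1.

    Fix k and unimodular (or zero) numbers w_al for the multi-indices al of
    degree k. On the Hilbert space with orthonormal basis e_be (be of degree
    less than k) and g, let T_j send e_be to e_{be + 1_j} if be has degree
    less than k - 1, and to c w_{be + 1_j} g if be has degree k - 1; let
    T_j g = 0. These operators commute because T^al e_0 is e_al, c w_al g or 0
    according to the degree of al. Below the top level T_j is a partial
    isometry, and on the level k - 1 it is a functional of norm at most
    c N^(1/2), where N = binom(d + k - 2, k - 1) is the number of
    multi-indices of degree k - 1; so c = N^(-1/2) makes T_j a contraction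
    ([test_op_le]). For 0 < t < 1 the tuple tT is strictly contractive, and the
    compression of f(tT) to the span of e_0 and g is the matrix
    [f_0, 0; X, f_0] with X = c t^k sum_{|al| = k} w_al f_al. It is a
    contraction, hence |X| <= 1 - |f_0|^2 ([corner_of_contraction_le]).
    Choosing the phases w_al and letting t tend to 1 gives
      sum_{|al| = k} |f_al| <= (1 - |f_0|^2) binom(d + k - 2, k - 1)^(1/2)
    ([agler_homogeneous_le]).

    Consequently, if sum_{k >= 1} r^k binom(d + k - 2, k - 1)^(1/2) <= 1/2,
    then the coefficients r^|al| f_al of f_r have absolute sum at most
    |f_0| + (1 - |f_0|^2) / 2 <= 1, so r is at most the Bohr-Agler radius
    ([bohr_agler_radius_ge]). That these are the coefficients of f_r is the
    uniqueness of power series coefficients ([expansion_coef]).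

    The series has value exactly 1/2 at a single positive point, because it is
    convex, strictly increasing, zero at 0, at least 1/2 at 1/2 and finite at
    3/4 ([half_root]). The explicit bound follows from
    binom(d + k - 2, k - 1) <= d^(k - 1), which compares the series with a
    geometric one whose sum at r = 1 / (d^(1/2) + 2) is 1/2. *)

(** * Norms over the complex numbers *)

Section Cnorm.
Variable R : realType.
Implicit Type V : normedModType R[i].

Lemma cnormE V (x : V) : (cnorm x)%:C%C = `|x|.
Proof. by rewrite RRe_real// ger0_real. Qed.

Lemma cnorm_ge0 V (x : V) : 0 <= cnorm x.
Proof. by rewrite -ler0c cnormE. Qed.

Lemma ler_cnormD V (x y : V) : cnorm (x + y) <= cnorm x + cnorm y.
Proof. by rewrite -lecR rmorphD /= !cnormE ler_normD. Qed.

Lemma cnormZ V (a : R[i]) (x : V) : cnorm (a *: x) = cnorm (a : R[i]^o) * cnorm x.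
Proof. by apply: complexI; rewrite rmorphM /= !cnormE normrZ. Qed.

Lemma cnorm0 V : cnorm (0 : V) = 0.
Proof. by rewrite /cnorm normr0. Qed.

Lemma cnorm_eq0 V (x : V) : cnorm x = 0 -> x = 0.
Proof. by move=> x0; apply/eqP; rewrite -normr_eq0 -cnormE x0. Qed.

Lemma cnormM (a b : R[i]^o) : cnorm (a * b : R[i]^o) = cnorm a * cnorm b.
Proof. exact: cnormZ. Qed.

Lemma cnorm_real (r : R) : cnorm (r%:C%C : R[i]^o) = `|r|.
Proof.
by apply: complexI; rewrite cnormE normc_def /= expr0n addr0 sqrtr_sqr.
Qed.

End Cnorm.

Lemma ReB (R : realType) (z w : R[i]) :
  complex.Re (z - w) = complex.Re z - complex.Re w.
Proof. by case: z w => [a b] [c d]. Qed.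

Lemma ImB (R : realType) (z w : R[i]) :
  complex.Im (z - w) = complex.Im z - complex.Im w.
Proof. by case: z w => [a b] [c d]. Qed.

Lemma norm_le_Re_Im (R : realType) (z : R[i]) :
  cnorm (z : R[i]^o) <= `|complex.Re z| + `|complex.Im z|.
Proof.
rewrite -lecR cnormE normc_def lecR.
rewrite -(@ler_pXn2r _ 2)// ?nnegrE ?sqrtr_ge0 ?addr_ge0//.
rewrite sqr_sqrtr ?addr_ge0 ?sqr_ge0// sqrrD !real_normK ?num_real//.
by rewrite addrAC lerDl mulrn_wge0// mulr_ge0.
Qed.

Lemma norm_Re_le (R : realType) (z : R[i]) : `|complex.Re z| <= cnorm (z : R[i]^o).
Proof.
rewrite -lecR cnormE normc_def lecR -sqrtr_sqr ler_wsqrtr// lerDl; exact: sqr_ge0.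
Qed.

Lemma norm_Im_le (R : realType) (z : R[i]) : `|complex.Im z| <= cnorm (z : R[i]^o).
Proof.
rewrite -lecR cnormE normc_def lecR -sqrtr_sqr ler_wsqrtr// lerDr; exact: sqr_ge0.
Qed.

(** * Finite-dimensional Hilbert spaces *)

(** An alias of the function space, so that it can carry the Euclidean norm. *)
Definition ell2 (R : realType) (I : finType) := {ffun I -> R[i]^o}.

Section Ell2.
Variables (R : realType) (I : finType).
HB.instance Definition _ := Vector.on (ell2 R I).

Definition ell2_dot (x y : ell2 R I) : R[i] := \sum_i x i * Num.conj (y i).

Lemma ell2_dot_bilinear : bilinear_for
  (GRing.Scale.Law.clone _ _ *%R _) (GRing.Scale.Law.clone _ _ (Num.conj \; *%R) _)
  ell2_dot.
Proof.
split=> u a x y; rewrite /ell2_dot /=.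
  rewrite mulr_sumr -big_split; apply: eq_bigr => i _.
  by rewrite !ffunE mulrDl mulrA.
rewrite mulr_sumr -big_split; apply: eq_bigr => i _.
by rewrite !ffunE rmorphD rmorphM mulrDr mulrCA.
Qed.

HB.instance Definition _ :=
  bilinear_isBilinear.Build R[i] (ell2 R I) (ell2 R I) R[i] _ _
    ell2_dot ell2_dot_bilinear.

Lemma ell2_dotC (x y : ell2 R I) :
  ell2_dot x y = (-1) ^+ false * Num.conj (ell2_dot y x).
Proof.
rewrite expr0 mul1r rmorph_sum; apply: eq_bigr => i _.
by rewrite rmorphM /= conjCK mulrC.
Qed.

HB.instance Definition _ :=
  isHermitianSesquilinear.Build R[i] (ell2 R I) false Num.conj
    ell2_dot ell2_dotC.

Lemma ell2ZE (a : R[i]) (x : ell2 R I) i : (a *: x) i = a * x i.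
Proof. by rewrite ffunE. Qed.

Lemma ell2BE (x y : ell2 R I) i : (x - y) i = x i - y i.
Proof. by rewrite !ffunE. Qed.

Lemma ell2_dotxx (x : ell2 R I) : ell2_dot x x = \sum_i `|x i| ^+ 2.
Proof. by apply: eq_bigr => i _; rewrite normCK. Qed.

Lemma ell2_dot_gt0 (x : ell2 R I) : x != 0 -> 0 < ell2_dot x x.
Proof.
move=> x0; rewrite ell2_dotxx lt0r sumr_ge0 ?andbT; last by move=> i _; rewrite exprn_ge0.
apply: contra x0 => /eqP/psumr_eq0P H; apply/eqP/ffunP => i; rewrite ffunE.
by apply/eqP; rewrite -normr_eq0 -sqrf_eq0 H // => j _; rewrite exprn_ge0.
Qed.

HB.instance Definition _ := isDotProduct.Build R[i] (ell2 R I) ell2_dot ell2_dot_gt0.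

Definition ell2_norm (x : ell2 R I) : R[i] := sqrtC (ell2_dot x x).

Lemma ler_ell2_normD (x y : ell2 R I) : ell2_norm (x + y) <= ell2_norm x + ell2_norm y.
Proof. exact: (triangle_lerif ell2_dot x y). Qed.

Lemma ell2_normZ (a : R[i]) (x : ell2 R I) : ell2_norm (a *: x) = `|a| * ell2_norm x.
Proof.
rewrite /ell2_norm linearZl_LR linearZr_LR /= mulrA -normCK.
by rewrite rootCMl ?exprn_ge0// sqrCK.
Qed.

Lemma ell2_norm_eq0 (x : ell2 R I) : ell2_norm x = 0 -> x = 0.
Proof.
move=> /eqP; rewrite /ell2_norm sqrtC_eq0 => /eqP x0; apply/eqP.
by apply: contraT => /ell2_dot_gt0; rewrite x0 ltxx.
Qed.

HB.instance Definition _ := Lmodule_isNormed.Build R[i] (ell2 R I)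
  ler_ell2_normD ell2_normZ ell2_norm_eq0.

Lemma ell2_normK (x : ell2 R I) : `|x| ^+ 2 = \sum_i `|x i| ^+ 2.
Proof. by rewrite -ell2_dotxx sqrtCK. Qed.

Lemma ell2_coord_le (x : ell2 R I) i : `|x i| <= `|x|.
Proof.
rewrite -(@ler_pXn2r _ 2)// ?nnegrE// ell2_normK (bigD1 i)//= lerDl.
by apply: sumr_ge0 => j _; rewrite exprn_ge0.
Qed.

Lemma ell2_norm_le_sum (x : ell2 R I) : `|x| <= \sum_i `|x i|.
Proof.
rewrite -(@ler_pXn2r _ 2)// ?nnegrE ?sumr_ge0// ell2_normK expr2 mulr_suml.
apply: ler_sum => i _; rewrite expr2 ler_wpM2l// (bigD1 i)//= lerDl.
exact: sumr_ge0.
Qed.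

(** Reduces completeness to that of the real line: the limit of a Cauchy filter
    is found through the real and imaginary parts of the coordinates. *)
Lemma cauchy_functional (F : set_system (ell2 R I)) (phi : ell2 R I -> R) :
  ProperFilter F -> cauchy F -> (forall x y, (`|phi x - phi y|)%:C%C <= `|x - y|) ->
  cvg (phi @ F).
Proof.
move=> FF /cauchyP cF phiL.
have phiF : ProperFilter (phi @ F) := fmap_proper_filter phi FF.
apply: cauchy_cvg; apply/cauchy_exP => e e0.
have [] := cF e%:C%C; first by rewrite ltcR.
move=> x Fx; exists (phi x).
suff: F (phi @^-1` ball (phi x) e) by [].
apply: filterS Fx => y; rewrite -ball_normE => /= xy.
rewrite -(@ball_normE _ R) /=.
by rewrite -ltcR; apply: le_lt_trans xy.
Qed.

Lemma ell2_complete (F : set_system (ell2 R I)) : ProperFilter F -> cauchy F -> cvg F.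
Proof.
move=> FF cF.
have cRe i : cvg ((fun x : ell2 R I => complex.Re (x i)) @ F).
  apply: cauchy_functional => // x y; apply: le_trans (ell2_coord_le (x - y) i).
  by rewrite ell2BE -(@cnormE _ R[i]^o) lecR -ReB norm_Re_le.
have cIm i : cvg ((fun x : ell2 R I => complex.Im (x i)) @ F).
  apply: cauchy_functional => // x y; apply: le_trans (ell2_coord_le (x - y) i).
  by rewrite ell2BE -(@cnormE _ R[i]^o) lecR -ImB norm_Im_le.
pose l : ell2 R I := [ffun i => Complex (lim ((fun x : ell2 R I => complex.Re (x i)) @ F))
  (lim ((fun x : ell2 R I => complex.Im (x i)) @ F))].
apply/cvg_ex; exists l; apply/cvgrPdist_le => e; rewrite ltcE /= => /andP[/eqP eIm e0].
have -> : e = (complex.Re e)%:C%C by case: e eIm {e0} => a b /= ->.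
move: (complex.Re e) e0 => {eIm}{}e e0.
(* Each of the 2 #|I| real coordinates may contribute this much; the successor
   keeps the denominator nonzero when I is empty. *)
have d0 : 0 < e / (#|I|.+1 * 2)%:R by rewrite divr_gt0// ltr0n.
have nRe : \forall x \near F, forall i : I,
    `|complex.Re (l i) - complex.Re ((x : ell2 R I) i)| <= e / (#|I|.+1 * 2)%:R.
  apply: filter_forall => i; rewrite ffunE /=.
  by have /cvgrPdist_le/(_ _ d0) := cRe i.
have nIm : \forall x \near F, forall i : I,
    `|complex.Im (l i) - complex.Im ((x : ell2 R I) i)| <= e / (#|I|.+1 * 2)%:R.
  apply: filter_forall => i; rewrite ffunE /=.
  by have /cvgrPdist_le/(_ _ d0) := cIm i.
apply: filterS2 nRe nIm => x xRe xIm.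
apply: le_trans (ell2_norm_le_sum _) _.
apply: (@le_trans _ _ (\sum_(i : I) (e / #|I|.+1%:R)%:C%C)).
  apply: ler_sum => i _; rewrite ell2BE -(@cnormE _ R[i]^o) lecR.
  apply: le_trans (norm_le_Re_Im _) _; rewrite ReB ImB.
  apply: le_trans (lerD (xRe i) (xIm i)) _; rewrite natrM le_eqVlt; apply/orP; left.
  by apply/eqP; field; rewrite nat1r pnatr_eq0.
rewrite -rmorph_sum /= lecR sumr_const -[leLHS]mulr_natr mulrAC ler_pdivrMr ?ltr0n//.
by rewrite ler_wpM2l ?(ltW e0)// ler_nat.
Qed.

HB.instance Definition _ := Uniform_isComplete.Build (ell2 R I) ell2_complete.

End Ell2.
Lemma hilbert_ell2 (R : realType) (I : finType) : hilbert (ell2 R I).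
Proof.
pose ip : {dot ell2 R I for Num.conj} := @ell2_dot R I.
by exists ip => x; rewrite ell2_normK -ell2_dotxx.
Qed.

(** * Operator norms and the functional calculus *)

Section OperatorNorm.
Variable R : realType.
Implicit Type V : normedModType R[i].

Lemma opnorm_le V (T : V -> V) (t : R) : 0 <= t ->
  (forall x, cnorm (T x) <= t * cnorm x) -> (opnorm T <= t%:E)%E.
Proof.
move=> t0 Tt; apply: ge_ereal_sup => _ [x /= x1 <-]; rewrite lee_fin.
by apply: le_trans (Tt x) _; rewrite ler_piMr.
Qed.

Lemma le_opnorm V (T : V -> V) x : cnorm x <= 1 -> ((cnorm (T x))%:E <= opnorm T)%E.
Proof. by move=> x1; apply: ereal_sup_ubound; exists x. Qed.

Lemma opnorm_contraction V (T : {linear V -> V}) x :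
  (opnorm T <= 1)%E -> cnorm (T x) <= cnorm x.
Proof.
move=> T1; have [x0|/eqP x0] := eqVneq (cnorm x) 0.
  by rewrite (cnorm_eq0 x0) linear0.
have x_gt0 : 0 < cnorm x by rewrite lt0r cnorm_ge0 andbT; exact/eqP.
have c1 : cnorm ((cnorm x)^-1%:C%C : R[i]^o) = (cnorm x)^-1.
  by rewrite cnorm_real ger0_norm// invr_ge0 ltW.
have : cnorm (T ((cnorm x)^-1%:C%C *: x)) <= 1.
  rewrite -lee_fin; apply: le_trans T1; apply: le_opnorm.
  by rewrite cnormZ c1 mulVf// gt_eqF.
by rewrite linearZ /= cnormZ c1 mulrC ler_pdivrMr// mul1r.
Qed.

End OperatorNorm.

(** If a coordinate of the finite partial sums of f(T) x is eventually constant,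
    then it is the coordinate of f(T) x, since a small operator norm makes every
    coordinate small. This replaces limits by finite algebra for the nilpotent
    test operators. *)
Lemma calculus_coord (R : realType) d (I : finType) (f : 'rV[R[i]^o]_d -> R[i]^o)
    (T : 'I_d -> {linear ell2 R I -> ell2 R I}) (S : {linear ell2 R I -> ell2 R I})
    (x : ell2 R I) i (c : R[i]) (A0 : {fset {ffun 'I_d -> nat}}) :
  is_calculus f T S -> cnorm x <= 1 ->
  (forall A, (A0 `<=` A)%fset ->
     (\sum_(al <- A) coef f al *: oppow T al x : ell2 R I) i = c) ->
  S x i = c.
Proof.
move=> [_ Scvg] x1 Ac; apply/eqP; rewrite -subr_eq0 -normr_eq0 -(@cnormE _ R[i]^o).
apply/eqP; congr (_%:C)%C; apply/eqP; rewrite eq_le cnorm_ge0 andbT.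
apply/ler_addgt0Pl => e e0; rewrite addr0.
have : nbhs 0%E (fun u : \bar R => (u < e%:E)%E).
  exact: lt_nbhsl.
move=> /Scvg [A1 _ /(_ (A0 `|` A1)%fset)].
rewrite /= => /(_ (fsubsetUr _ _)) De.
have := le_lt_trans (le_opnorm _ x1) De; rewrite lte_fin => /ltW.
apply: le_trans; rewrite -lecR !cnormE.
have := ell2_coord_le (S x - \sum_(al <- (A0 `|` A1)%fset) coef f al *: oppow T al x) i.
by rewrite !ffunE Ac// fsubsetUl.
Qed.

(** * Multi-indices and powers of commuting operators *)

Section Oppow.
Variables (R : realType) (d : nat) (H : normedModType R[i]).
Local Notation multiindex := {ffun 'I_d -> nat}.

Definition unit_index (j : 'I_d) : multiindex := [ffun i => (i == j) : nat].

Definition mdeg (al : multiindex) : nat := (\sum_j al j)%N.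

Lemma multiindexE (al : multiindex) : al = \sum_j unit_index j *+ al j.
Proof.
apply/ffunP => i; rewrite sum_ffunE (bigD1 i)//= ffunMnE ffunE eqxx natn big1 ?addr0// => j ij.
by rewrite ffunMnE ffunE eq_sym (negPf ij) mul0rn.
Qed.

Lemma mdegD al be : mdeg (al + be) = (mdeg al + mdeg be)%N.
Proof. by rewrite /mdeg -big_split; apply: eq_bigr => j _; rewrite ffunE. Qed.

Lemma mdeg_unit j : mdeg (unit_index j) = 1%N.
Proof.
rewrite /mdeg (bigD1 j)//= ffunE eqxx big1// => i ij.
by rewrite ffunE (negPf ij).
Qed.

Lemma mdeg0 : mdeg 0 = 0%N.
Proof. by rewrite /mdeg big1// => i _; rewrite ffunE. Qed.

Lemma leq_mdeg (al : multiindex) j : (al j <= mdeg al)%N.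
Proof. by rewrite /mdeg (bigD1 j)//= leq_addr. Qed.

Lemma mdeg_eq0 al : (mdeg al == 0%N) = (al == 0).
Proof.
apply/eqP/eqP => [al0|->]; last exact: mdeg0.
by apply/ffunP => j; rewrite ffunE; apply/eqP; rewrite -leqn0 -al0 leq_mdeg.
Qed.

(** Operators that act on a family of vectors by shifting its index have powers
    that can be read off; the family need not be linearly independent. *)
Lemma oppow_shift (T : 'I_d -> {linear H -> H}) (v : multiindex -> H) (t : R[i]) :
  (forall j ga, T j (v ga) = t *: v (ga + unit_index j)) ->
  forall al ga, oppow T al (v ga) = t ^+ mdeg al *: v (ga + al).
Proof.
move=> Tv al ga; rewrite /oppow [X in _ = _ *: v (_ + X)](multiindexE al) /mdeg.
have iterE n j s be : iter n (T j) (s *: v be) = (s * t ^+ n) *: v (be + unit_index j *+ n).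
  elim: n => [|n IHn]; first by rewrite mulr1 mulr0n addr0.
  by rewrite iterS IHn linearZ /= Tv scalerA -mulrA -exprSr mulrSr addrA.
elim: (index_enum _) => [|j r IHr]; first by rewrite !big_nil addr0 scale1r.
rewrite !big_cons /= IHr iterE; congr (_ *: v _); first by rewrite -exprD addnC.
by rewrite -addrA; congr (_ + _); rewrite addrC.
Qed.

End Oppow.

(** * The test operators *)

(** Cauchy-Schwarz against the constant function, in the form
    sum_{i, j} (a_i - a_j)^2 >= 0. *)
Lemma sqr_sum_le (F : numFieldType) (I : finType) (P : pred I) (a : I -> F) :
  (forall i, 0 <= a i) ->
  (\sum_(i | P i) a i) ^+ 2 <= #|P|%:R * \sum_(i | P i) a i ^+ 2.
Proof.
move=> a0; set S := \sum_(i | P i) a i ^+ 2; rewrite -(@ler_pM2l _ 2)//.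
have -> : 2 * (#|P|%:R * S) = \sum_(i | P i) \sum_(j | P j) (a i ^+ 2 + a j ^+ 2).
  under eq_bigr do rewrite big_split /= sumr_const.
  by rewrite big_split /= sumr_const sumrMnl -mulr2n mulr_natl mulr_natl.
rewrite expr2 mulr_suml mulr_sumr; apply: ler_sum => i _.
rewrite !mulr_sumr; apply: ler_sum => j _.
rewrite -subr_ge0; have -> : a i ^+ 2 + a j ^+ 2 - 2 * (a i * a j) = (a i - a j) ^+ 2.
  by ring.
by rewrite real_exprn_even_ge0// rpredB// ger0_real.
Qed.

Lemma sum_sqr_norm_at_most1 (F : numDomainType) (I : finType) (P : pred I) (x : I -> F) :
  (forall i j, P i -> P j -> i = j) ->
  `|\sum_(i | P i) x i| ^+ 2 = \sum_(i | P i) `|x i| ^+ 2.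
Proof.
move=> P1; case: (pickP P) => [i Pi|P0]; last first.
  by rewrite !big_pred0// normr0 expr0n.
have PE : P =1 pred1 i by move=> j; apply/idP/eqP => [Pj|->//]; exact: P1.
by rewrite !(big_pred1 i).
Qed.

Lemma sum_option (V : nmodType) (I : finType) (F : option I -> V) :
  \sum_i F i = F None + \sum_i F (Some i).
Proof.
rewrite (bigD1 None)//=; congr (_ + _).
rewrite (reindex_omap Some id)//=; last by case.
by apply: eq_bigl => i; rewrite eqxx.
Qed.

Section Model.
Variables (R : realType) (d m : nat).
Local Notation multiindex := {ffun 'I_d -> nat}.
Local Notation idx := {ffun 'I_d -> 'I_m.+1}.
Local Notation H := (ell2 R (option idx)).

(** The multi-indices of degree at most m are embedded in a finite type; the
    members of that type of larger degree span a harmless extra summand, which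
    the test operators annihilate. *)
Definition multiindex_of (b : idx) : multiindex := [ffun j => b j : nat].
Definition idx_of (al : multiindex) : idx := [ffun j => inord (al j)].

Lemma multiindex_ofK : cancel multiindex_of idx_of.
Proof. by move=> b; apply/ffunP => j; rewrite !ffunE inord_val. Qed.

Lemma idx_ofK al : (mdeg al <= m)%N -> multiindex_of (idx_of al) = al.
Proof.
move=> alm; apply/ffunP => j; rewrite !ffunE inordK// ltnS.
exact: leq_trans (leq_mdeg al j) alm.
Qed.

Definition basis_vector (i : option idx) : H := [ffun i' => (i' == i)%:R].

Lemma norm_basis_vector i : cnorm (basis_vector i) = 1.
Proof.
apply: complexI; rewrite cnormE; apply/eqP; rewrite -(@eqrXn2 _ 2)//.
rewrite ell2_normK (bigD1 i)//= ffunE eqxx normr1 big1 ?addr0 => [|j ji]; last first.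
  by rewrite ffunE (negPf ji) normr0 expr0n.
by rewrite !expr1n.
Qed.

Definition level_card : nat := #|[pred b : idx | mdeg (multiindex_of b) == m]|.

Variables (c : R) (w : multiindex -> R[i]) (t : R).
Hypotheses (c0 : 0 <= c) (cN : c ^+ 2 * level_card%:R <= 1).
Hypothesis (w1 : forall al, `|w al| <= 1).
Hypothesis (t0 : 0 <= t).

(** The vector T^al e_0 for t = 1: the index None stands for the extra basis
    vector g. *)
Definition test_vector (al : multiindex) : H :=
  if (mdeg al <= m)%N then basis_vector (Some (idx_of al))
  else if mdeg al == m.+1 then (c%:C%C * w al) *: basis_vector None else 0.

(** The multiple by t of the operator that maps T^be e_0 to T^(be + 1_j) e_0, for be
    of degree at most m, and kills the other basis vectors. *)
Definition test_op (j : 'I_d) (x : H) : H :=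
  t%:C%C *: \sum_(b | (mdeg (multiindex_of b) <= m)%N)
    x (Some b) *: test_vector (multiindex_of b + unit_index j).

Lemma test_vectorS al b :
  test_vector al (Some b) = ((mdeg al <= m)%N && (b == idx_of al))%:R.
Proof.
rewrite /test_vector; case: ifP => _; first by rewrite ffunE (inj_eq Some_inj).
by case: ifP => _; rewrite !ffunE//; exact: mulr0.
Qed.

Lemma test_vectorN al :
  test_vector al None = if mdeg al == m.+1 then c%:C%C * w al else 0.
Proof.
rewrite /test_vector; case: leqP => [alm|_].
  by rewrite ffunE ltn_eqF.
by case: ifP => _; rewrite !ffunE//; exact: mulr1.
Qed.

Lemma test_op_linear j : linear (test_op j).
Proof.
move=> a x y; rewrite /test_op scalerA mulrC -scalerA -scalerDr; congr (_ *: _).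
rewrite scaler_sumr -big_split; apply: eq_bigr => b _.
by rewrite !ffunE scalerDl scalerA.
Qed.

HB.instance Definition _ j :=
  GRing.isLinear.Build R[i] H H *:%R (test_op j) (test_op_linear j).

Let test_opZ j (a : R[i]) (x : H) : test_op j (a *: x) = a *: test_op j x.
Proof. exact: (scalable_linear (test_op_linear j)). Qed.

Lemma test_op_vector j al :
  test_op j (test_vector al) = t%:C%C *: test_vector (al + unit_index j).
Proof.
rewrite /test_op; congr (_ *: _); have [alm|alm] := leqP (mdeg al) m.
  rewrite (bigD1 (idx_of al)) ?idx_ofK//= big1 ?addr0 => [|b /andP[_ bal]].
    by rewrite test_vectorS alm eqxx scale1r.
  by rewrite test_vectorS (negPf bal) andbF scale0r.
have -> : test_vector (al + unit_index j) = 0.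
  rewrite /test_vector mdegD mdeg_unit addn1 leqNgt ltnS (ltnW alm)/= eqSS.
  by rewrite gtn_eqF.
by rewrite big1// => b _; rewrite test_vectorS leqNgt alm scale0r.
Qed.

(** Both composites send the basis vector of index be to the test vector of
    index be + 1_i + 1_j. *)
Lemma test_op_comm i j x : test_op i (test_op j x) = test_op j (test_op i x).
Proof.
have E k l : test_op k (test_op l x) =
    (t%:C%C ^+ 2) *: \sum_(b | (mdeg (multiindex_of b) <= m)%N)
      x (Some b) *: test_vector (multiindex_of b + (unit_index l + unit_index k)).
  rewrite [test_op l x]/test_op test_opZ.
  rewrite (linear_sum (test_op k : {linear _ -> _})) /= !scaler_sumr.
  apply: eq_bigr => b _; rewrite test_opZ test_op_vector addrA !scalerA.
  by rewrite expr2 mulrAC.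
by rewrite !E [unit_index j + unit_index i]addrC.
Qed.

(** The images of the basis vectors of degree below m are distinct basis vectors
    and those of degree m are multiples of g, so the two groups of
    coordinates are estimated separately: the first by injectivity of the
    shift, the second by Cauchy-Schwarz and the size of c. *)
Lemma test_op_le j x : cnorm (test_op j x) <= t * cnorm x.
Proof.
rewrite cnormZ cnorm_real ger0_norm// ler_wpM2l// -lecR !cnormE.
set y := \sum_(b | _) _.
rewrite -(@ler_pXn2r _ 2)// ?nnegrE// !ell2_normK !sum_option.
pose lower (b : idx) := (mdeg (multiindex_of b) < m)%N.
pose top (b : idx) := mdeg (multiindex_of b) == m.
have ySome b' : y (Some b') =
    \sum_(b | lower b && (idx_of (multiindex_of b + unit_index j) == b')) x (Some b).
  rewrite /y sum_ffunE [RHS]big_mkcond [LHS]big_mkcond; apply: eq_bigr => b _.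
  rewrite ell2ZE test_vectorS mdegD mdeg_unit addn1 /lower [_ == b']eq_sym.
  case: (ltnP (mdeg (multiindex_of b)) m) => bm /=; last by rewrite mulr0 if_same.
  by case: eqP => _; rewrite /= ?mulr1 ?mulr0 (ltnW bm).
have yNone : y None =
    c%:C%C * \sum_(b | top b) w (multiindex_of b + unit_index j) * x (Some b).
  rewrite mulr_sumr /y sum_ffunE [RHS]big_mkcond [LHS]big_mkcond; apply: eq_bigr => b _.
  rewrite ell2ZE test_vectorN mdegD mdeg_unit addn1 /top eqSS.
  case: (ltngtP (mdeg (multiindex_of b)) m) => //= bm; rewrite ?mulr0//.
  by rewrite mulrC mulrA.
have top_le : `|y None| ^+ 2 <= \sum_(b | top b) `|x (Some b)| ^+ 2.
  rewrite yNone normrM exprMn normc_def /= expr0n addr0 sqrtr_sqr ger0_norm// -rmorphXn /=.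
  apply: (@le_trans _ _ ((c ^+ 2)%:C%C * (#|top|%:R * \sum_(b | top b) `|x (Some b)| ^+ 2))).
    rewrite ler_wpM2l ?ler0c ?sqr_ge0//; apply: le_trans (sqr_sum_le _ _) => //.
    rewrite ler_pXn2r ?nnegrE ?sumr_ge0//; apply: le_trans (ler_norm_sum _ _ _) _.
    by apply: ler_sum => b _; rewrite normrM ler_piMl.
  rewrite mulrA ler_piMl ?sumr_ge0//.
  by rewrite -(rmorph_nat (real_complex R)) -rmorphM /= lecR.
have lower_le : \sum_b `|y (Some b)| ^+ 2 <= \sum_(b | lower b) `|x (Some b)| ^+ 2.
  rewrite [leRHS](partition_big (fun b => idx_of (multiindex_of b + unit_index j)) predT)//=.
  apply: ler_sum => b' _; rewrite ySome sum_sqr_norm_at_most1// => b1 b2.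
  move=> /andP[lb1 /eqP <-] /andP[lb2 /eqP /(congr1 multiindex_of)].
  rewrite !idx_ofK ?mdegD ?mdeg_unit ?addn1// => /ffunP h.
  apply: (can_inj multiindex_ofK); apply/ffunP => i; have := h i.
  by rewrite ffunE [RHS]ffunE => /addIn ->.
apply: le_trans (lerD top_le lower_le) _.
apply: ler_wpDl; first exact: exprn_ge0.
rewrite [leRHS](bigID top)/= lerD2l [leRHS](bigID lower)/=.
rewrite [X in X + _](eq_bigl lower) => [|b]; last first.
  by rewrite /top /lower ltn_neqAle andbA andbb.
by rewrite lerDl sumr_ge0// => b _; rewrite exprn_ge0.
Qed.

Lemma opnorm_test_op_lt1 j : t < 1 -> (opnorm (test_op j) < 1)%E.
Proof. by move=> t1; apply: le_lt_trans (opnorm_le t0 (test_op_le j)) _. Qed.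

End Model.

(** * Homogeneous parts of Agler class functions *)

(** A multi-index is a weak composition of its degree. *)
Lemma level_cardE n m : level_card n.+1 m = 'C(n + m, m).
Proof.
rewrite /level_card -bin_sub ?leq_addl// addnK -card_ord_partitions -!sum1_card.
pose phi (t : n.+1.-tuple 'I_m.+1) : {ffun 'I_n.+1 -> 'I_m.+1} := [ffun j => tnth t j].
rewrite (reindex phi) /=; last first.
  exists (fun b : {ffun 'I_n.+1 -> 'I_m.+1} => [tuple b j | j < n.+1]) => [t _|b _].
    by apply: eq_from_tnth => j; rewrite tnth_mktuple ffunE.
  by apply/ffunP => j; rewrite ffunE tnth_mktuple.
apply: eq_bigl => t; rewrite !inE big_tuple /mdeg.
by congr (_ == _); apply: eq_bigr => j _; rewrite !ffunE.
Qed.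

(** The limit t -> 1, made explicit with Bernoulli's inequality. *)
Lemma le_of_expr_mul_le (R : realFieldType) (k : nat) (F B : R) : 0 <= F ->
  (forall t, 0 < t < 1 -> t ^+ k * F <= B) -> F <= B.
Proof.
move=> F0 tB; rewrite leNgt; apply/negP => BF.
have B0 : 0 <= B by apply: le_trans (tB (2^-1) _); [rewrite mulr_ge0 ?exprn_ge0|lra].
have F_gt0 : 0 < F by exact: le_lt_trans BF.
(* With t = 1 - s, Bernoulli leaves F - k s F, which exceeds B since
   k s F < (k + 2) s F = F - B. *)
pose s := (F - B) / (F * k.+2%:R).
have k2 : 2 <= k.+2%:R :> R by rewrite ler_nat.
have Fk : 0 < F * k.+2%:R by rewrite mulr_gt0// ltr0n.
have s0 : 0 < s by rewrite divr_gt0// subr_gt0.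
have s1 : s < 1.
  rewrite ltr_pdivrMr// mul1r; nra.
have bern : 1 - k%:R * s <= (1 - s) ^+ k.
  elim: (k) => [|n IHn]; first by rewrite mul0r subr0.
  rewrite exprS; apply: le_trans (_ : (1 - s) * (1 - n%:R * s) <= _); last first.
    by rewrite ler_wpM2l// subr_ge0 ltW.
  rewrite -natr1; have : 0 <= n%:R :> R by []. 
  nra.
have /tB : 0 < 1 - s < 1 by apply/andP; split; lra.
rewrite leNgt => /negP; apply.
apply: lt_le_trans (_ : (1 - k%:R * s) * F <= _); last by rewrite ler_wpM2r.
have sE : s * F * k.+2%:R = F - B by rewrite /s; field; lra.
have : k.+2%:R = k%:R + 2 :> R by rewrite -addn2 natrD.
have : 0 < s * F by rewrite mulr_gt0.
nra.
Qed.

(** A contractive lower triangular matrix [z, 0; X, z] has X <= 1 - |z|^2. The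
    vector with entries 1 - |z|^2 and conj(z) X is chosen so that its image has
    second entry X; it gives (1 - |z|^2) X^2 <= (1 - |z|^2)^3. *)
Lemma corner_of_contraction_le (R : realType) (z : R[i]^o) (X : R) : 0 <= X ->
  (forall a b : R[i]^o, cnorm (a * z) ^+ 2 + cnorm (a * X%:C%C + b * z) ^+ 2 <=
     cnorm a ^+ 2 + cnorm b ^+ 2) ->
  X <= 1 - cnorm z ^+ 2.
Proof.
move=> X0 contr; set p := cnorm z.
have p0 : 0 <= p := cnorm_ge0 _.
have pX : p ^+ 2 + X ^+ 2 <= 1.
  have := contr 1 0; rewrite !mul1r mul0r addr0 cnorm_real ger0_norm//.
  have -> : cnorm (1 : R[i]^o) = 1 by rewrite /cnorm normr1.
  by rewrite cnorm0 expr0n addr0 expr1n.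
have zz : z^* * z = (p ^+ 2)%:C%C by rewrite mulrC -normCK rmorphXn /= cnormE.
have := contr (1 - p ^+ 2)%:C%C (z^* * X%:C%C).
have -> : (1 - p ^+ 2)%:C%C * X%:C%C + z^* * X%:C%C * z = X%:C%C :> R[i].
  by rewrite mulrAC zz -!rmorphM -rmorphD /=; congr (_%:C)%C; ring.
have -> : cnorm (z^* * X%:C%C : R[i]^o) = p * X.
  rewrite cnormM cnorm_real ger0_norm//; congr (_ * _).
  by apply: complexI; rewrite !cnormE norm_conjC.
rewrite cnormM !cnorm_real -/p !ger0_norm//; last nra.
move=> h.
(* If |z| = 1 the previous inequality is trivial, but the image of the first
   basis vector already forces X = 0. *)
have [p1|p1] := eqVneq (p ^+ 2) 1.
  by move: pX; rewrite p1; nra.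
have q0 : 0 < 1 - p ^+ 2 by rewrite lt_neqAle eq_sym subr_eq0 eq_sym p1/= subr_ge0; nra.
have : (1 - p ^+ 2) * (X ^+ 2) <= (1 - p ^+ 2) * ((1 - p ^+ 2) ^+ 2) by nra.
by rewrite ler_pM2l// ler_pXn2r ?nnegrE// ltW.
Qed.

Section Estimate.
Variables (R : realType) (d m : nat).
Local Notation multiindex := {ffun 'I_d -> nat}.
Local Notation idx := {ffun 'I_d -> 'I_m.+1}.
Local Notation H := (ell2 R (option idx)).
Variables (f : 'rV[R[i]^o]_d -> R[i]^o) (A : {fset multiindex}) (c t : R).
Variable w : multiindex -> R[i].
Hypotheses (A_deg : forall al, al \in A -> mdeg al = m.+1).
Hypotheses (c0 : 0 <= c) (cN : c ^+ 2 * (level_card d m)%:R <= 1).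
Hypothesis w1 : forall al, `|w al| <= 1.
Hypothesis wA : forall al, al \notin A -> w al = 0.
Hypothesis t01 : 0 < t < 1.

Local Notation T := (fun j => test_op c w t j : {linear H -> H}).
Local Notation i0 := (idx_of m (0 : multiindex)).
Local Notation e0 := (basis_vector R (Some (i0))).
Local Notation g := (basis_vector R (None : option idx)).

Lemma idx_of_eq0 (al : multiindex) : (mdeg al <= m)%N -> (idx_of m al == i0) = (al == 0).
Proof.
move=> alm; apply/eqP/eqP => [|->//] /(congr1 (@multiindex_of d m)).
by rewrite !idx_ofK// mdeg0.
Qed.

Lemma test_vector0 : test_vector m c w 0 = e0.
Proof. by rewrite /test_vector mdeg0. Qed.

Lemma oppow_test_bottom al : oppow T al e0 = t%:C%C ^+ mdeg al *: test_vector m c w al.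
Proof.
rewrite -test_vector0 (@oppow_shift _ _ _ T (test_vector m c w) t%:C%C) ?add0r// => j ga.
exact: test_op_vector.
Qed.

(** The vector g is killed by every test operator; it is put in the scope of the
    shift formula through the family that vanishes off the index 0. *)
Lemma oppow_test_top al : oppow T al g = if al == 0 then g else 0.
Proof.
pose v (ga : multiindex) : H := if ga == 0 then g else 0.
have vE : v 0 = g by rewrite /v eqxx.
rewrite -[in LHS]vE (@oppow_shift _ _ _ T v t%:C%C) ?add0r.
  by rewrite /v; case: eqP => [->|]; rewrite ?mdeg0 ?scale1r ?scaler0.
move=> j ga.
have -> : v (ga + unit_index j) = 0.
  by rewrite /v -mdeg_eq0 mdegD mdeg_unit addn1.
rewrite scaler0 /v; case: ifP => _; last exact: linear0.
rewrite /= /test_op big1 ?scaler0// => b _.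
by rewrite ffunE scale0r.
Qed.

(** The four entries of the compression of f(T) to the span of e_0 and g. Each
    becomes constant along the finite sets that contain 0 or A: the former
    carries the constant term, the latter supports the weight w. *)
Lemma calculus_corner (S : {linear H -> H}) : is_calculus f T S ->
  let X := \sum_(al <- A) coef f al * (c%:C%C * t%:C%C ^+ m.+1 * w al) in
  [/\ S e0 (Some (i0)) = coef f 0, S e0 None = X,
      S g (Some (i0)) = 0 & S g None = coef f 0].
Proof.
move=> fTS X.
have coordE (B : {fset multiindex}) (x : H) i :
    (\sum_(al <- B) coef f al *: oppow T al x : H) i =
    \sum_(al <- B) coef f al * (oppow T al x : H) i.
  by rewrite sum_ffunE; apply: eq_bigr => al _; rewrite ell2ZE.
have zero_only (B : {fset multiindex}) (F : multiindex -> R[i]) :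
    ([fset 0%R] `<=` B)%fset -> (forall al, al != 0 -> F al = 0) ->
    \sum_(al <- B) F al = F 0.
  rewrite fsub1set => B0 F0; rewrite (big_fsetD1 0)//= big_seq big1 ?addr0// => al.
  by rewrite !inE => /andP[al0 _]; exact: F0.
have n1 i : cnorm (basis_vector R i : H) <= 1 by rewrite norm_basis_vector.
split.
- apply: (calculus_coord (A0 := [fset 0%R]%fset) fTS (n1 _)) => B B0.
  rewrite coordE zero_only// => [|al al0]; rewrite oppow_test_bottom.
    by rewrite mdeg0 expr0 scale1r test_vectorS mdeg0 eqxx mulr1.
  rewrite ell2ZE test_vectorS; case: leqP => alm; rewrite ?mulr0//.
  by rewrite eq_sym idx_of_eq0// (negPf al0) !mulr0.
- apply: (calculus_coord (A0 := A) fTS (n1 _)) => B AB.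
  pose F (al : multiindex) := coef f al * (oppow T al e0 : H) None.
  rewrite coordE -(@big_fset_incl _ _ _ _ A B F AB); last first.
    move=> al _ alA; rewrite /F oppow_test_bottom ell2ZE test_vectorN wA//.
    by rewrite mulr0 if_same !mulr0.
  rewrite /X big_seq [RHS]big_seq; apply: eq_bigr => al /A_deg alm.
  rewrite /F oppow_test_bottom ell2ZE test_vectorN alm eqxx.
  by rewrite [X in _ * X = _]mulrCA !mulrA.
- apply: (calculus_coord (A0 := [fset 0%R]%fset) fTS (n1 _)) => B B0.
  rewrite coordE zero_only// => [|al al0]; rewrite oppow_test_top ?eqxx ?(negPf al0).
    by rewrite ffunE mulr0.
  by rewrite ffunE mulr0.
- apply: (calculus_coord (A0 := [fset 0%R]%fset) fTS (n1 _)) => B B0.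
  rewrite coordE zero_only// => [|al al0]; rewrite oppow_test_top ?eqxx ?(negPf al0).
    by rewrite ffunE eqxx mulr1.
  by rewrite ffunE mulr0.
Qed.

Lemma agler_corner_le (X : R) : agler_class f -> 0 <= X ->
  \sum_(al <- A) coef f al * (c%:C%C * t%:C%C ^+ m.+1 * w al) = X%:C%C ->
  X <= 1 - cnorm (coef f 0) ^+ 2.
Proof.
move=> [_ fagler] X0 XE; have [t0 t1] := andP t01.
have [S [fTS S1]] : exists S : {linear H -> H}, is_calculus f T S /\ (opnorm S <= 1)%E.
  apply: fagler; first exact: hilbert_ell2.
    by move=> i j x; exact: test_op_comm.
  by move=> j; apply: opnorm_test_op_lt1 => //; exact: ltW.
have [Se0 Se0N Sg SgN] := calculus_corner fTS.
apply: corner_of_contraction_le => // a b.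
pose x : H := a *: e0 + b *: g.
have xE i : x i = a * (i == Some i0)%:R + b * (i == None)%:R.
  by rewrite /x ffunE !ell2ZE !ffunE.
have sq (y : H) : (cnorm y ^+ 2)%:C%C = \sum_i (cnorm (y i) ^+ 2)%:C%C.
  rewrite rmorphXn /= cnormE ell2_normK; apply: eq_bigr => i _.
  by rewrite rmorphXn /= cnormE.
have -> : cnorm a ^+ 2 + cnorm b ^+ 2 = cnorm x ^+ 2.
  apply: complexI; rewrite sq sum_option rmorphD /= addrC; congr (_ + _); last first.
    by rewrite xE eqxx mulr0 add0r mulr1.
  rewrite (bigD1 i0)//= big1 ?addr0 => [|i ii0].
    by rewrite xE eqxx mulr0 addr0 mulr1.
  by rewrite xE (inj_eq Some_inj) (negPf ii0) !mulr0 addr0 cnorm0 expr0n.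
have SxE i : S x i = a * S e0 i + b * S g i.
  have SZ (u : R[i]) (y : H) : S (u *: y) = u *: S y by rewrite linearZ.
  by rewrite /x linearD !SZ ffunE !ell2ZE.
have := opnorm_contraction x S1; rewrite -(@ler_pXn2r _ 2)// ?nnegrE ?cnorm_ge0//.
apply: le_trans; rewrite -lecR sq sum_option (bigD1 i0)//= !SxE Se0 Sg Se0N SgN XE.
rewrite mulr0 addr0 rmorphD /= [leLHS]addrC lerD2l lerDl.
by apply: sumr_ge0 => i _; rewrite ler0c sqr_ge0.
Qed.

End Estimate.

(** The coefficient inequality behind the theorem. The phases are taken to be
    zero off the finite set A, which turns the corner entry into the sum of
    the absolute values over A. *)
Lemma agler_homogeneous_le (R : realType) (n m : nat) (f : 'rV[R[i]^o]_n.+1 -> R[i]^o)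
    (A : {fset {ffun 'I_n.+1 -> nat}}) :
  agler_class f -> (forall al, al \in A -> mdeg al = m.+1) ->
  \sum_(al <- A) cnorm (coef f al) <=
    (1 - cnorm (coef f 0) ^+ 2) * Num.sqrt ('C(n + m, m)%:R).
Proof.
move=> fA Adeg; set N := 'C(n + m, m).
have N0 : 0 < Num.sqrt N%:R :> R by rewrite sqrtr_gt0 ltr0n bin_gt0 leq_addl.
apply: (@le_of_expr_mul_le _ m.+1) => [|t t01].
  by apply: sumr_ge0 => al _; exact: cnorm_ge0.
rewrite -ler_pdivrMr//.
pose w (al : {ffun 'I_n.+1 -> nat}) : R[i] :=
  if al \in A then `|coef f al| / coef f al else 0.
have fw al : al \in A -> coef f al * w al = (cnorm (coef f al))%:C%C.
  rewrite /w cnormE => ->; have [->|z0] := eqVneq (coef f al) 0.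
    by rewrite mul0r normr0.
  by rewrite mulrC divfK.
have [t0 _] := andP t01.
apply: (@agler_corner_le _ _ m f A (Num.sqrt N%:R)^-1 t w) => //.
- rewrite level_cardE -/N exprVn sqr_sqrtr ?ler0n// mulVf//.
  by rewrite pnatr_eq0 -lt0n bin_gt0 leq_addl.
- move=> al; rewrite /w; case: ifP => _; last by rewrite normr0.
  rewrite normrM normfV normr_id; have [->|z0] := eqVneq (coef f al) 0.
    by rewrite normr0 mul0r.
  by rewrite divff// normr_eq0.
- by move=> al /negPf alA; rewrite /w alA.
- rewrite divr_ge0 ?(ltW N0)// mulr_ge0 ?exprn_ge0 ?(ltW t0)//.
  by apply: sumr_ge0 => al _; exact: cnorm_ge0.
- rewrite [in RHS]mulrC mulr_sumr mulr_sumr rmorph_sum /= big_seq [RHS]big_seq.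
  apply: eq_bigr => al alA; rewrite mulrCA fw//.
  by rewrite !rmorphM /= rmorphXn mulrA.
Qed.

(** * Unconditionally convergent sums *)

(** The terms of each sign are summed separately. *)
Lemma sum_norm_le (R : realDomainType) (I : eqType) (r : seq I) (x : I -> R) (K : R) :
  (forall P : pred I, `|\sum_(i <- r | P i) x i| <= K) ->
  \sum_(i <- r) `|x i| <= K *+ 2.
Proof.
move=> xK; rewrite (bigID (fun i => 0 <= x i))/= mulr2n; apply: lerD.
  rewrite (eq_bigr x) => [|i xi]; last by rewrite ger0_norm.
  exact: le_trans (ler_norm _) (xK _).
rewrite (eq_bigr (fun i => - x i)) => [|i]; last first.
  by rewrite -ltNge => /ltW xi; rewrite ler0_norm.
by rewrite sumrN; apply: le_trans (ler_norm _) _; rewrite normrN.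
Qed.

Lemma ler_sum_fset (R : numDomainType) (I : choiceType) (F : I -> R) (A B : {fset I}) :
  (A `<=` B)%fset -> (forall i, 0 <= F i) -> \sum_(i <- A) F i <= \sum_(i <- B) F i.
Proof.
move=> AB F0; rewrite [leRHS](big_fsetID _ (mem A))/=.
rewrite (_ : [fset x in B | x \in A]%fset = A) ?lerDl ?sumr_ge0//.
by apply/fsetP => i; rewrite !inE/=; apply: andb_idl => /(fsubsetP AB).
Qed.

Lemma sum_fsetU (V : nmodType) (I : choiceType) (F : I -> V) (A B : {fset I}) :
  [disjoint A & B]%fset ->
  \sum_(i <- (A `|` B)%fset) F i = \sum_(i <- A) F i + \sum_(i <- B) F i.
Proof.
move=> /fdisjointP dAB; rewrite (big_fsetID _ (mem A))/=; congr (_ + _); apply: eq_fbigl => i;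
  rewrite !inE/=; first by case: (i \in A); rewrite ?andbF.
by case: (boolP (i \in A)) => [/dAB/negPf ->|_]; rewrite ?andbF ?andbT.
Qed.

#[local] Existing Instance totally_filter.

Section Summation.
Variables (R : realType) (I : choiceType).
Implicit Type u : I -> R[i]^o.

Lemma partial_sumE u (A : {fset I}) : partial_sum u A = \sum_(i <- A) u i.
Proof. by rewrite /partial_sum big_seq_fsetE. Qed.

Lemma has_sum_near u s (e : R) : has_sum u s -> 0 < e ->
  exists A0 : {fset I}, forall A, (A0 `<=` A)%fset ->
    cnorm (\sum_(i <- A) u i - s : R[i]^o) <= e.
Proof.
move=> us e0; have e0' : 0 < e%:C%C by rewrite ltcR.
move/cvgrPdist_le : us => /(_ _ e0')[A0 _ A0e].
exists A0 => A A0A; have := A0e A A0A.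
by rewrite /= distrC partial_sumE -lecR cnormE.
Qed.

(** In the complex field unconditional convergence is absolute: outside a finite set A0
    all finite sums are bounded by 2, and so are the sums of the real parts and
    of the imaginary parts over the terms of one sign. *)
Lemma has_sum_abs_bounded u s : has_sum u s ->
  exists M : R, forall A : {fset I}, \sum_(i <- A) cnorm (u i) <= M.
Proof.
move=> us; have [A0 A0u] := has_sum_near us ltr01.
exists (\sum_(i <- A0) cnorm (u i) + 8) => A.
have sub2 (P : pred I) : cnorm (\sum_(i <- (A `\` A0)%fset | P i) u i : R[i]^o) <= 2.
  rewrite big_fset_condE; set B := [fset i | i in _ & _]%fset.
  have B0 : [disjoint A0 & B]%fset.
    by apply/fdisjointP => i iA0; rewrite !inE iA0.
  have -> : \sum_(i <- B) u i = (\sum_(i <- (A0 `|` B)%fset) u i - s) - (\sum_(i <- A0) u i - s).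
    by rewrite sum_fsetU//= opprB addrA subrK addrC addKr.
  apply: le_trans (ler_cnormD _ _) _; rewrite -[2]/(1 + 1); apply: lerD.
    exact: A0u (fsubsetUl _ _).
  by rewrite /cnorm normrN; exact: A0u.
have Re_sum (P : pred I) : complex.Re (\sum_(i <- (A `\` A0)%fset | P i) u i) =
    \sum_(i <- (A `\` A0)%fset | P i) complex.Re (u i).
  by elim/big_rec2: _ => // i a b _ <-; case: (u i) b => [? ?] [? ?].
have Im_sum (P : pred I) : complex.Im (\sum_(i <- (A `\` A0)%fset | P i) u i) =
    \sum_(i <- (A `\` A0)%fset | P i) complex.Im (u i).
  by elim/big_rec2: _ => // i a b _ <-; case: (u i) b => [? ?] [? ?].
apply: (@le_trans _ _ (\sum_(i <- (A0 `|` (A `\` A0))%fset) cnorm (u i))).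
  apply: ler_sum_fset => [|i]; last exact: cnorm_ge0.
  by apply/fsubsetP => i iA; rewrite !inE iA andbT orbN.
rewrite sum_fsetU/=; last by apply/fdisjointP => i iA0; rewrite !inE iA0.
rewrite lerD2l.
apply: (@le_trans _ _ (\sum_(i <- (A `\` A0)%fset) `|complex.Re (u i)| +
    \sum_(i <- (A `\` A0)%fset) `|complex.Im (u i)|)).
  by rewrite -big_split; apply: ler_sum => i _; exact: norm_le_Re_Im.
have -> : 8 = 2 *+ 2 + 2 *+ 2 :> R by ring.
apply: lerD; apply: sum_norm_le => P.
  by rewrite -Re_sum; apply: le_trans (norm_Re_le _) (sub2 P).
by rewrite -Im_sum; apply: le_trans (norm_Im_le _) (sub2 P).
Qed.

End Summation.

(** * Uniqueness of power series coefficients *)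

Section Digits.
Variables (B : nat).

Lemma digits_lt d (a : 'I_d -> nat) : (forall j, a j < B)%N ->
  (\sum_j a j * B ^ j < B ^ d)%N.
Proof.
elim: d a => [|d IHd] a aB; first by rewrite big_ord0.
rewrite big_ord_recr /= expnS; have := IHd (fun j => a (widen_ord (leqnSn d) j)).
move=> /(_ (fun _ => aB _)) lt; apply: leq_trans (_ : B ^ d + a ord_max * B ^ d <= _)%N.
  by rewrite ltn_add2r.
by rewrite -mulSn leq_mul2r aB orbT.
Qed.

Lemma digits_inj d (a b : 'I_d -> nat) : (forall j, a j < B)%N -> (forall j, b j < B)%N ->
  (\sum_j a j * B ^ j = \sum_j b j * B ^ j)%N -> a =1 b.
Proof.
elim: d a b => [|d IHd] a b aB bB; first by move=> _ [].
have B0 : (0 < B)%N by apply: leq_ltn_trans (aB ord0).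
have shift (x : 'I_d.+1 -> nat) : (\sum_j x j * B ^ j =
    (\sum_(j < d) x (lift ord0 j) * B ^ j) * B + x ord0)%N.
  rewrite big_ord_recl /= expn0 muln1 addnC big_distrl /=; congr addn.
  by apply: eq_bigr => j _; rewrite -mulnA -expnSr.
rewrite !shift => E.
have E0 : a ord0 = b ord0.
  by have := congr1 (modn^~ B) E; rewrite !modnMDl !modn_small.
have E1 : forall j, a (lift ord0 j) = b (lift ord0 j).
  apply: IHd => //.
  by move: E; rewrite E0 => /addIn /eqP; rewrite eqn_pmul2r// => /eqP.
by move=> j; have [j' ->|->] := unliftP ord0 j.
Qed.

End Digits.

Section Uniqueness.
Variables (R : realType) (d : nat).
Local Notation multiindex := {ffun 'I_d -> nat}.
Implicit Types (a b : multiindex -> R[i]^o) (f : 'rV[R[i]^o]_d -> R[i]^o).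

Definition weight (m : 'I_d -> nat) (al : multiindex) : nat := (\sum_j al j * m j)%N.

(** On the curve with coordinates s^(m_j) a power series in several variables
    becomes a series of powers of s, with exponents the weights. *)
Lemma monomial_curve (m : 'I_d -> nat) (s : R) (al : multiindex) :
  monomial (\row_j (s ^+ m j)%:C%C) al = (s ^+ weight m al)%:C%C.
Proof.
rewrite /monomial /weight -prodrXr rmorph_prod /=; apply: eq_bigr => j _.
by rewrite mxE -rmorphXn /= -exprM mulnC.
Qed.

(** Distinct multi-indices can share a weight, but not at or below the weight of
    a given multi-index. With B larger than its degree, the weights
    B^j + B^d make the weight of be a number whose remainder modulo B^d has the
    entries of be as digits in base B and whose quotient is the degree. *)
Lemma separating_weight (al : multiindex) : exists m : 'I_d -> nat,
  (forall j, 0 < m j)%N /\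
  forall be ga, (weight m be <= weight m al)%N -> weight m ga = weight m be -> ga = be.
Proof.
pose B := (mdeg al).+1; pose m (j : 'I_d) := (B ^ j + B ^ d)%N.
exists m; split=> [j|be ga bal gbe]; first by rewrite addn_gt0 expn_gt0.
have wE (x : multiindex) : weight m x = (mdeg x * B ^ d + \sum_j x j * B ^ j)%N.
  rewrite /weight /mdeg big_distrl -big_split /=; apply: eq_bigr => j _.
  by rewrite mulnDr addnC.
have small (x : multiindex) : (mdeg x < B)%N -> forall j, (x j < B)%N.
  by move=> xB j; apply: leq_ltn_trans (leq_mdeg x j) xB.
have deg_small (x : multiindex) : (weight m x <= weight m al)%N -> (mdeg x < B)%N.
  move=> xal; have : (mdeg x * B ^ d < B * B ^ d)%N.
    apply: leq_ltn_trans (leq_addr (\sum_j x j * B ^ j) _) _; rewrite -wE.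
    apply: leq_ltn_trans xal _; rewrite wE mulSn addnC ltn_add2r.
    exact: digits_lt (small _ _).
  by rewrite ltn_pmul2r// expn_gt0.
have beB := small _ (deg_small _ bal).
have gaB : forall j, (ga j < B)%N by apply/small/deg_small; rewrite gbe.
apply/ffunP; apply: (digits_inj gaB beB).
have := congr1 (modn^~ (B ^ d)%N) gbe.
by rewrite !wE !modnMDl !modn_small// digits_lt.
Qed.

(** A nonzero coefficient of least weight w would, along the curve above,
    dominate the others: at s = tau / 2 its term has size K tau^w, whereas the
    remaining terms sum to at most M tau^(w + 1), where M bounds the absolute
    sums at s = 1/2. This fails as tau tends to 0. *)
Lemma expansion0_coef (c : multiindex -> R[i]^o) :
  (forall z, polydisk z -> has_sum (fun al => c al * monomial z al : R[i]^o) 0) ->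
  forall al, c al = 0.
Proof.
move=> c_sum al0; apply: contrapT => /eqP cal0.
have [m [m0 m_inj]] := separating_weight al0.
have exw : exists n, `[< exists al, c al != 0 /\ weight m al = n >].
  by exists (weight m al0); apply/asboolP; exists al0.
case: (ex_minnP exw) => w /asboolP[al [cal alw]] w_min.
have wal0 : (w <= weight m al0)%N by apply: w_min; apply/asboolP; exists al0.
have w_lt be : be != al -> c be != 0 -> (w < weight m be)%N.
  move=> beal cbe; rewrite ltn_neqAle w_min ?andbT; last by apply/asboolP; exists be.
  by apply: contra beal => /eqP wbe; apply/eqP/m_inj; rewrite alw.
have poly (s : R) : 0 < s < 1 -> polydisk (\row_j (s ^+ m j)%:C%C : 'rV[R[i]^o]_d).
  move=> /andP[s0 s1] j; rewrite mxE cnorm_real ger0_norm ?exprn_ge0 ?ltW//.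
  by rewrite exprn_ilt1 ?ltW// -lt0n.
have h01 : 0 < (2^-1 : R) < 1 by apply/andP; split; lra.
have [M M_sum] := has_sum_abs_bounded (c_sum _ (poly 2^-1 h01)).
have termE (s : R) be : 0 < s ->
    cnorm (c be * monomial (\row_j (s ^+ m j)%:C%C) be : R[i]^o) =
    cnorm (c be) * s ^+ weight m be.
  by move=> s0; rewrite monomial_curve cnormM cnorm_real ger0_norm// exprn_ge0// ltW.
pose K := cnorm (c al) * 2^-1 ^+ w.
have K0 : 0 < K.
  rewrite mulr_gt0 ?exprn_gt0// ?invr_gt0// lt0r cnorm_ge0 andbT.
  by apply: contra cal => /eqP /cnorm_eq0 ->.
have half0 : 0 < (2^-1 : R) by case/andP: h01.
have KM : K <= M.
  by have := M_sum [fset al]%fset; rewrite big_seq_fset1 (termE _ _ half0) alw.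
have tau_le (tau : R) : 0 < tau < 1 -> K <= tau * M.
  move=> /andP[tau0 tau1].
  have s01 : 0 < tau / 2 < 1 by apply/andP; split; lra.
  have s0 : 0 < tau / 2 by case/andP: s01.
  rewrite -(@ler_pM2l _ (tau ^+ w)) ?exprn_gt0// [leRHS]mulrA -exprSr.
  apply/ler_addgt0Pr => e e0.
  have [A0 A0e] := has_sum_near (c_sum _ (poly _ s01)) e0.
  have := A0e (al |` A0)%fset (fsubsetUr _ _).
  rewrite (big_fsetD1 al) ?fset1U1//= subr0.
  set rest := \sum_(i <- _) _ => le_e.
  have -> : tau ^+ w * K = cnorm (c al * monomial (\row_j ((tau / 2) ^+ m j)%:C%C) al : R[i]^o).
    by rewrite termE// alw exprMn /K mulrCA.
  have rest_le : cnorm (rest : R[i]^o) <= tau ^+ w.+1 * M.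
    apply: (@le_trans _ _ (\sum_(be <- ((al |` A0) `\ al)%fset)
       cnorm (c be * monomial (\row_j ((tau / 2) ^+ m j)%:C%C) be : R[i]^o))).
      rewrite /rest; elim/big_rec2: _ => [|be x y _ xy]; first by rewrite cnorm0.
      by apply: le_trans (ler_cnormD _ _) _; rewrite lerD2l.
    apply: le_trans (ler_wpM2l _ (M_sum ((al |` A0) `\ al)%fset)); last first.
      by rewrite exprn_ge0// ltW.
    rewrite mulr_sumr big_seq [leRHS]big_seq; apply: ler_sum => be.
    rewrite !inE => /andP[beal _]; rewrite (termE _ _ s0) (termE _ _ half0).
    have [->|cbe] := eqVneq (c be) 0; first by rewrite cnorm0 !mul0r mulr0.
    rewrite mulrCA ler_wpM2l ?cnorm_ge0// exprMn ler_wpM2r ?exprn_ge0//.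
    by rewrite ler_wiXn2l// ?ltW// w_lt.
  apply: le_trans (lerD rest_le le_e).
  have := ler_cnormD
    (c al * monomial (\row_j ((tau / 2) ^+ m j)%:C%C) al + rest : R[i]^o) (- rest).
  have restN : cnorm (- rest : R[i]^o) = cnorm (rest : R[i]^o) by rewrite /cnorm normrN.
  by rewrite addrK restN [leRHS]addrC.
have M0 : 0 < M := lt_le_trans K0 KM.
have /tau_le : 0 < K / (M *+ 2) < 1.
  rewrite divr_gt0 ?mulrn_wgt0//= ltr_pdivrMr ?mulrn_wgt0// mul1r mulr2n.
  by apply: le_lt_trans KM _; rewrite ltrDl.
have -> : K / (M *+ 2) * M = K / 2 by field; rewrite gt_eqF.
lra.
Qed.

Lemma expansion_coef f a : expansion f a -> coef f = a.
Proof.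
move=> fa; have fc : expansion f (coef f).
  by exact: (@xgetPex _ (fun=> 0) (expansion f) (ex_intro _ a fa)).
apply/funext => al; apply/eqP; rewrite -subr_eq0; apply/eqP.
move: al; apply: expansion0_coef => z zD.
rewrite /has_sum (_ : partial_sum _ =
    partial_sum (fun al => coef f al * monomial z al : R[i]^o) \-
    partial_sum (fun al => a al * monomial z al : R[i]^o)).
  by rewrite -(subrr (f z)); exact: cvgB (fc z zD) (fa z zD).
apply/funext => A; rewrite /= !partial_sumE -sumrB.
by apply: eq_bigr => be _; rewrite mulrBl.
Qed.

Lemma coef_dilate f (r : R) : 0 < r < 1 -> expansion f (coef f) ->
  coef (dilate r f) = fun al => coef f al * (r ^+ mdeg al)%:C%C.
Proof.
move=> /andP[r0 r1] fe; apply: expansion_coef => z zD.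
have rzD : polydisk (r%:C%C *: z).
  move=> j; rewrite mxE cnormM cnorm_real ger0_norm ?ltW//.
  have := zD j; have := cnorm_ge0 (z 0 j); nra.
rewrite /dilate (_ : (fun _ => _) =
    (fun al => coef f al * monomial (r%:C%C *: z) al : R[i]^o)); first exact: fe.
apply/funext => al; rewrite -mulrA; congr (_ * _).
rewrite /monomial /mdeg rmorphXn -prodrXr -big_split /=; apply: eq_bigr => j _.
by rewrite mxE exprMn.
Qed.

End Uniqueness.

(** * The point where a power series takes the value one half *)

(** The power series sum_{k >= 1} c_{k - 1} r^k is handled through its partial
    sums, so that no question of convergence arises; its value is their
    supremum. *)
Section HalfRoot.
Variables (R : realType) (c : nat -> R).
Hypotheses (c_ge0 : forall m, 0 <= c m) (c0 : c 0%N = 1).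

Definition psum (N : nat) (r : R) : R := \sum_(m < N) r ^+ m.+1 * c m.

Definition psum_sup (r s : R) : Prop :=
  (forall N, psum N r <= s) /\ forall B, (forall N, psum N r <= B) -> s <= B.

Lemma psum_le N (x y : R) : 0 <= x -> x <= y -> psum N x <= psum N y.
Proof.
move=> x0 xy; apply: ler_sum => m _; rewrite ler_wpM2r// lerXn2r// nnegrE//.
exact: le_trans xy.
Qed.

Lemma psum_ge0 N (x : R) : 0 <= x -> 0 <= psum N x.
Proof. by move=> x0; apply: sumr_ge0 => m _; rewrite mulr_ge0// exprn_ge0. Qed.

Lemma convex_expr (l x y : R) n : 0 <= l <= 1 -> 0 <= x <= y ->
  ((1 - l) * x + l * y) ^+ n <= (1 - l) * x ^+ n + l * y ^+ n.
Proof.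
move=> /andP[l0 l1] /andP[x0 xy]; have y0 := le_trans x0 xy.
elim: n => [|n IHn]; first by rewrite !expr0 !mulr1 subrK.
have z0 : 0 <= (1 - l) * x + l * y by rewrite addr_ge0// mulr_ge0// subr_ge0.
rewrite !exprS; apply: le_trans (ler_wpM2l z0 IHn) _.
rewrite -subr_ge0 (_ : _ - _ = l * (1 - l) * ((y - x) * (y ^+ n - x ^+ n))); last by ring.
by rewrite !mulr_ge0// subr_ge0// lerXn2r.
Qed.

Lemma convex_psum (l x y : R) N : 0 <= l <= 1 -> 0 <= x <= y ->
  psum N ((1 - l) * x + l * y) <= (1 - l) * psum N x + l * psum N y.
Proof.
move=> l01 xy; rewrite /psum !mulr_sumr -big_split; apply: ler_sum => m _ /=.
by rewrite !mulrA -mulrDl ler_wpM2r// convex_expr.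
Qed.

(** Strict monotonicity with a margin that does not depend on N, carried by the
    linear term. *)
Lemma psum_gap N (x y : R) : 0 <= x -> x <= y -> psum N x + (y - x) <= psum N.+1 y.
Proof.
move=> x0 xy; rewrite -lerBrDl; have : psum N x <= psum N.+1 x.
  by rewrite /psum [leRHS]big_ord_recr lerDl mulr_ge0 ?exprn_ge0.
move=> xN; rewrite (_ : y - x = y ^+ 1 * c 0 - x ^+ 1 * c 0); last by rewrite c0 !mulr1.
suff : psum N.+1 x + (y ^+ 1 * c 0 - x ^+ 1 * c 0) <= psum N.+1 y by lra.
rewrite /psum !big_ord_recl /= addrC addrA subrK lerD2l.
apply: ler_sum => m _; rewrite ler_wpM2r// lerXn2r// nnegrE//.
exact: le_trans xy.
Qed.

Variables (y M : R).
Hypotheses (y_gt : 1 / 2 < y) (psum_y : forall N, psum N y <= M).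

(** Continuity to the right, obtained from convexity: on the segment from x to y
    the value stays below the chord joining B to M. *)
Let grow (x B : R) : 0 <= x -> x <= 1 / 2 -> B < 1 / 2 -> (forall N, psum N x <= B) ->
  exists2 z, x < z & 0 <= z /\ forall N, psum N z <= 1 / 2.
Proof.
move=> x0 x_half B_half xB.
have B0 : 0 <= B by apply: le_trans (xB 0%N); rewrite /psum big_ord0.
have M0 : 0 <= M by apply: le_trans (psum_y 0%N); rewrite /psum big_ord0.
(* Small enough that the chord is at most 1/2 at the parameter l. *)
pose l := (1 / 2 - B) / (M + 1).
have l0 : 0 < l by rewrite divr_gt0//; lra.
have lE : l * (M + 1) = 1 / 2 - B by rewrite /l divfK// gt_eqF//; lra.
have l1 : l <= 1 by rewrite /l ler_pdivrMr; lra.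
clearbody l.
have xy_lt : x < y by exact: le_lt_trans x_half y_gt.
have lxy : 0 < l * (y - x) by rewrite mulr_gt0// subr_gt0.
exists ((1 - l) * x + l * y); first by
  rewrite -subr_gt0 (_ : _ - x = l * (y - x)) //; ring.
split=> [|N]; first by rewrite addr_ge0// mulr_ge0// ?subr_ge0// ?(ltW l0)// (le_trans x0)// ltW.
have l01 : 0 <= l <= 1 by rewrite ltW.
have xy : 0 <= x <= y by rewrite x0/= ltW.
apply: le_trans (convex_psum N l01 xy) _.
have l1' : 0 <= 1 - l by rewrite subr_ge0.
apply: le_trans (lerD (ler_wpM2l l1' (xB N)) (ler_wpM2l (ltW l0) (psum_y N))) _.
have lB : 0 <= l * (B + 1) by rewrite mulr_ge0 ?(ltW l0)//; lra.
rewrite -subr_ge0 (_ : _ - _ = l * (B + 1)) //.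
have -> : 1 / 2 = B + l * (M + 1) by rewrite lE; ring.
ring.
Qed.

(** The root is the supremum of the points where the series is at most 1/2. *)
Lemma half_root : exists r0 : R, [/\ 0 < r0 < 1, forall N, psum N r0 <= 1 / 2 &
  unique (fun r => 0 < r /\ psum_sup r (1 / 2)) r0].
Proof.
pose E := [set r : R | 0 <= r /\ forall N, psum N r <= 1 / 2].
have ubE : ubound E (1 / 2).
  by move=> r [_ /(_ 1%N)]; rewrite /psum big_ord1 expr1 c0 mulr1.
have psum0 N : psum N 0 <= 0.
  by rewrite /psum big1// => m _; rewrite expr0n mul0r.
have E0 : E 0 by split=> // N; apply: le_trans (psum0 N) _; lra.
have hubE : has_ubound E by exists (1 / 2).
pose r0 := sup E.
have r0_half : r0 <= 1 / 2 by apply: ge_sup => //; exists 0.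
have r0_gt0 : 0 < r0.
  have half0 : 0 < 1 / 2 :> R by lra.
  have [z z0 Ez] := grow (lexx 0) (ltW half0) half0 psum0.
  exact: lt_le_trans z0 (ub_le_sup hubE Ez).
(* For t < 1 the point t r0 lies below a point where the series is at most 1/2,
   and t^N psum N r0 <= psum N (t r0) since the degree is N. *)
have Er0 N : psum N r0 <= 1 / 2.
  apply: (@le_of_expr_mul_le _ N); first exact: psum_ge0 (ltW r0_gt0).
  move=> t /andP[t0 t1].
  have [||r Er tr] := @sup_adherent _ E ((1 - t) * r0).
  - by rewrite mulr_gt0// subr_gt0.
  - by split=> //; exists 0.
  have {}tr : t * r0 <= r by apply: ltW; apply: le_lt_trans tr; rewrite -/r0; nra.
  have := Er.2 N; apply: le_trans; apply: le_trans (psum_le N _ tr); last first.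
    by rewrite mulr_ge0// ltW.
  rewrite /psum mulr_sumr; apply: ler_sum => m _.
  rewrite mulrA ler_wpM2r// exprMn ler_wpM2r ?exprn_ge0 ?(ltW r0_gt0)//.
  by rewrite ler_wiXn2l// ltW.
exists r0; split=> //; first by rewrite r0_gt0/=; lra.
split.
  split=> //; split=> // B r0B; rewrite leNgt; apply/negP => B_half.
  have [z r0z Ez] := grow (ltW r0_gt0) r0_half B_half r0B.
  by have := ub_le_sup hubE Ez; rewrite leNgt r0z.
move=> r [r_gt0 [r_le r_sup]].
have rr0 : r <= r0 by apply: ub_le_sup => //; split=> //; exact: ltW.
apply/eqP; rewrite eq_le rr0 andbT leNgt; apply/negP => r_lt.
have /r_sup : forall N, psum N r <= 1 / 2 - (r0 - r).
  by move=> N; have := psum_gap N (ltW r_gt0) rr0; have := Er0 N.+1; lra.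
lra.
Qed.

End HalfRoot.

(** * Estimates of the binomial series *)

Section BinomialSeries.
Variables (R : realType) (n : nat).

Lemma geometric_psum_le (x : R) N : 0 <= x -> (1 - x) * \sum_(m < N) x ^+ m <= 1.
Proof.
move=> x0; rewrite -opprB mulNr -subrX1 opprB.
by rewrite gerBl exprn_ge0.
Qed.

Lemma binomial_le_expr m : ('C(n + m, m) <= n.+1 ^ m)%N.
Proof.
elim: m => [|m IHm]; first by rewrite addn0 bin0.
rewrite -(@leq_pmul2l m.+1)// -mul_bin_diag addnS /= expnS.
rewrite mulnA; apply: leq_mul => //; nia.
Qed.

(** The partial sums of the expansion of (1 - x)^(-(n + 1)); Pascal's rule shows that
    multiplication by 1 - x lowers n by one. *)
Lemma binomial_series_le (x : R) N : 0 <= x -> x < 1 ->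
  (1 - x) ^+ n.+1 * \sum_(m < N) x ^+ m * 'C(n + m, m)%:R <= 1.
Proof.
move=> x0 x1; elim: n N => [|k IHk] N.
  rewrite expr1; under eq_bigr do rewrite add0n binn mulr1.
  exact: geometric_psum_le.
set P := \sum_(m < N) _.
have P_step : (1 - x) * P <= \sum_(m < N.+1) x ^+ m * 'C(k + m, m)%:R.
  have PE : P + x ^+ N * 'C(k.+1 + N, N)%:R =
      \sum_(m < N.+1) x ^+ m * 'C(k + m, m)%:R + x * P.
    transitivity (\sum_(m < N.+1) x ^+ m * 'C(k.+1 + m, m)%:R).
      by rewrite [RHS]big_ord_recr.
    rewrite !big_ord_recl /= !bin0 -addrA; congr (_ + _).
    rewrite mulr_sumr -big_split; apply: eq_bigr => m _ /=.
    rewrite /bump /= add1n addSn binS natrD mulrDr addnS -addSn; congr (_ + _).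
    by rewrite exprS mulrA.
  have : 0 <= x ^+ N * 'C(k.+1 + N, N)%:R by rewrite mulr_ge0 ?exprn_ge0 ?ler0n.
  lra.
rewrite exprSr -mulrA; apply: le_trans (IHk N.+1).
by rewrite ler_wpM2l// exprn_ge0// subr_ge0 ltW.
Qed.

End BinomialSeries.

(** * The Bohr-Agler radius *)

Section Bohr.
Variables (R : realType) (n : nat).
Local Notation multiindex := {ffun 'I_n.+1 -> nat}.

(** The coefficient of r^(m + 1) in the series of the theorem when d = n + 1. *)
Definition bohr_coef (m : nat) : R := Num.sqrt ('C(n + m, m)%:R).

Lemma bohr_coef_ge0 m : 0 <= bohr_coef m. Proof. exact: sqrtr_ge0. Qed.

Lemma bohr_coef0 : bohr_coef 0 = 1.
Proof. by rewrite /bohr_coef bin0 sqrtr1. Qed.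

(** The power series expansion is part of the functional calculus, so any tuple
    will do; the zero operators on a one-dimensional space are used. *)
Lemma agler_expansion (f : 'rV[R[i]^o]_n.+1 -> R[i]^o) :
  agler_class f -> expansion f (coef f).
Proof.
move=> [_ fA].
have [|||S [[fe _] _]] := fA (ell2 R unit) _ (fun _ => (\0 : {linear _ -> _})) _ _ => //.
- exact: hilbert_ell2.
- move=> j; apply: (@le_lt_trans _ _ 0%:E) => //; apply: opnorm_le => // x.
  by rewrite mul0r cnorm0.
Qed.

(** Grouping by degree gives at most p + (1 - p^2) / 2 = 1 - (1 - p)^2 / 2, where
    p = |f_0|. *)
Lemma sum_coef_le (f : 'rV[R[i]^o]_n.+1 -> R[i]^o) (r : R) (X : {fset multiindex}) :
  agler_class f -> 0 < r < 1 -> (forall N, psum bohr_coef N r <= 1 / 2) ->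
  \sum_(al <- X) cnorm (coef f al) * r ^+ mdeg al <= 1.
Proof.
move=> fA /andP[r0 r1] r_half; set p := cnorm (coef f 0).
pose N := \max_(al <- X) mdeg al.
have XN al : al \in X -> (mdeg al <= N)%N.
  by move=> alX; rewrite /N (big_rem al)//= leq_maxl.
(* The coefficient inequality for the empty set and degree 1. *)
have p2 : 0 <= 1 - p ^+ 2.
  have := @agler_homogeneous_le _ n 0 f fset0 fA.
  by rewrite big_seq_fset0 bin0 sqrtr1 mulr1; apply.
have level (k : nat) : \sum_(al <- X | mdeg al == k) cnorm (coef f al) * r ^+ mdeg al =
    r ^+ k * \sum_(al <- [fset al in X | mdeg al == k]%fset) cnorm (coef f al).
  rewrite -big_fset_condE mulr_sumr; apply: eq_bigr => al /eqP ->.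
  by rewrite mulrC.
have -> : \sum_(al <- X) cnorm (coef f al) * r ^+ mdeg al =
    \sum_(k < N.+1) r ^+ k * \sum_(al <- [fset al in X | mdeg al == k]%fset) cnorm (coef f al).
  rewrite big_seq (partition_big (fun al => inord (mdeg al) : 'I_N.+1) predT)//=.
  apply: eq_bigr => k _; rewrite -level [RHS]big_seq_cond; apply: eq_bigl => al.
  by apply: andb_id2l => /XN alN; rewrite -val_eqE /= inordK.
rewrite big_ord_recl expr0 mul1r.
have constant_le : \sum_(al <- [fset al in X | mdeg al == 0%N]%fset) cnorm (coef f al) <= p.
  apply: (@le_trans _ _ (\sum_(al <- [fset 0%R : multiindex]%fset) cnorm (coef f al))).
    apply: ler_sum_fset => [|al]; last exact: cnorm_ge0.
    by apply/fsubsetP => al; rewrite !inE mdeg_eq0 => /andP[].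
  by rewrite big_seq_fset1.
have higher_le : \sum_(m < N) r ^+ bump 0 m *
    (\sum_(al <- [fset al in X | mdeg al == bump 0 m]%fset) cnorm (coef f al)) <=
    (1 - p ^+ 2) * psum bohr_coef N r.
  rewrite mulr_sumr; apply: ler_sum => m _; rewrite /bump /= add1n mulrCA.
  rewrite ler_wpM2l ?exprn_ge0 ?(ltW r0)//; apply: agler_homogeneous_le => // al.
  by rewrite !inE => /andP[_ /eqP].
apply: le_trans (lerD constant_le higher_le) _.
have := ler_wpM2l p2 (r_half N); have := sqr_ge0 (1 - p).
have -> : (1 - p) ^+ 2 = 1 - p *+ 2 + p ^+ 2 by ring.
lra.
Qed.

Lemma bohr_agler_radius_ge (r : R) : 0 < r < 1 ->
  (forall N, psum bohr_coef N r <= 1 / 2) -> r <= bohr_agler_radius R n.+1.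
Proof.
move=> r01 r_half; apply: ub_le_sup.
  by exists 1 => x [/andP[_ /ltW]].
split=> // f fA; apply: ge_ereal_sup => _ [D [finD _] <-].
rewrite fsbig_finite// sumEFin lee_fin (coef_dilate r01 (agler_expansion fA)).
have -> : \sum_(al <- fset_set D) cnorm (coef f al * (r ^+ mdeg al)%:C%C : R[i]^o) =
    \sum_(al <- fset_set D) cnorm (coef f al) * r ^+ mdeg al.
  apply: eq_bigr => al _; rewrite cnormM cnorm_real ger0_norm// exprn_ge0//.
  by case/andP: r01 => /ltW.
exact: sum_coef_le.
Qed.

Lemma bohr_series_le (r B : R) : 0 <= r -> 0 <= B ->
  (\sum_(1 <= k <oo) (r ^+ k * Num.sqrt ('C(n.+1 + k - 2, k - 1)%N%:R))%:E <= B%:E)%E <->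
  forall N, psum bohr_coef N r <= B.
Proof.
move=> r0 B0; pose F k : \bar R := (r ^+ k * Num.sqrt ('C(n.+1 + k - 2, k - 1)%N%:R))%:E.
have F0 k : (1 <= k)%N -> true -> (0 <= F k)%E.
  by move=> _ _; rewrite /F lee_fin mulr_ge0 ?exprn_ge0 ?sqrtr_ge0.
have FE N : (\sum_(1 <= k < N.+1) F k = (psum bohr_coef N r)%:E)%E.
  rewrite big_add1 /= big_mkord sumEFin; congr _%:E; apply: eq_bigr => m _.
  by rewrite /bohr_coef subn1 /= addSn addnS !subSS subn0.
split=> [le_B N|le_B].
  by rewrite -lee_fin -FE; apply: le_trans (nneseries_lim_ge N.+1 F0) le_B.
apply: (lime_le (is_cvg_nneseries F0)); apply: nearW => -[|N].
  by rewrite big_geq// lee_fin.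
by rewrite FE lee_fin.
Qed.

Lemma bohr_series_eq (r : R) : 0 <= r ->
  (\sum_(1 <= k <oo) (r ^+ k * Num.sqrt ('C(n.+1 + k - 2, k - 1)%N%:R))%:E
     = (1 / 2 : R)%:E)%E <-> psum_sup bohr_coef r (1 / 2).
Proof.
move=> r0; have half0 : 0 <= 1 / 2 :> R by lra.
have psum_nneg B : (forall N, psum bohr_coef N r <= B) -> 0 <= B.
  by move=> /(_ 0%N); rewrite /psum big_ord0.
split=> [E|[le_half half_le]].
  split=> [|B leB]; first by apply/bohr_series_le => //; rewrite E.
  have B0 := psum_nneg _ leB.
  by move: leB => /(bohr_series_le r0 B0); rewrite E lee_fin.
apply/eqP; rewrite eq_le; apply/andP; split; first exact/bohr_series_le.
set s := limn _; rewrite leNgt; apply/negP => s_lt.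
have s0 : (0 <= s)%E.
  by apply: nneseries_ge0 => k _ _; rewrite lee_fin mulr_ge0 ?exprn_ge0 ?sqrtr_ge0.
have [B sB] : exists B : R, s = B%:E.
  by exists (fine s); rewrite fineK// ge0_fin_numE// (lt_trans s_lt)// ltry.
have B0 : 0 <= B by rewrite -lee_fin -sB.
have : 1 / 2 <= B by apply: half_le; apply/(bohr_series_le r0 B0); rewrite -/s sB.
by move: s_lt; rewrite sB lte_fin; lra.
Qed.

Lemma bohr_coef_le m : bohr_coef m <= Num.sqrt n.+1%:R ^+ m.
Proof.
rewrite /bohr_coef -(@ler_pXn2r _ 2)// ?nnegrE ?sqrtr_ge0 ?exprn_ge0//.
rewrite sqr_sqrtr ?ler0n// exprAC sqr_sqrtr ?ler0n// -natrX ler_nat.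
exact: binomial_le_expr.
Qed.

(** The square root of an integer is at most the integer, so the binomial series
    at 3/4 is a bound; any point strictly between 1/2 and 1 would do. *)
Lemma psum_bohr_bounded N : psum bohr_coef N (3 / 4) <= (3 / 4) * 4 ^+ n.+1.
Proof.
apply: (@le_trans _ _ (3 / 4 * \sum_(m < N) (3 / 4) ^+ m * 'C(n + m, m)%:R)).
  rewrite mulr_sumr; apply: ler_sum => m _; rewrite exprS -mulrA ler_wpM2l//.
  rewrite ler_wpM2l ?exprn_ge0// /bohr_coef.
  rewrite -(@ler_pXn2r _ 2)// ?nnegrE ?sqrtr_ge0// sqr_sqrtr ?ler0n//.
  by rewrite -natrX ler_nat expnS expn1 leq_pmulr// bin_gt0 leq_addl.
rewrite ler_wpM2l//.
have := @binomial_series_le R n (3 / 4) N; rewrite (_ : 1 - 3 / 4 = 4^-1); last by field.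
rewrite exprVn ler_pdivrMl ?exprn_gt0// mulr1; apply; lra.
Qed.

(** For q = d^(1/2) and r = 1 / (q + 2) one has 1 - r q = 2 r, so the majorizing
    geometric series r / (1 - r q) is 1/2. *)
Lemma psum_bohr_half N : psum bohr_coef N (1 / (Num.sqrt n.+1%:R + 2)) <= 1 / 2.
Proof.
set q := Num.sqrt _; have q0 : 0 <= q by exact: sqrtr_ge0.
set r := 1 / _; have r0 : 0 < r by rewrite divr_gt0//; lra.
have rq : 1 - r * q = r * 2 by rewrite /r; field; lra.
clearbody r.
apply: (@le_trans _ _ (r * \sum_(m < N) (r * q) ^+ m)).
  rewrite mulr_sumr; apply: ler_sum => m _.
  rewrite exprS exprMn -mulrA ler_wpM2l ?(ltW r0)//.
  by apply: ler_wpM2l (bohr_coef_le m); rewrite exprn_ge0 ?ltW.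
have rq0 : 0 <= r * q by rewrite mulr_ge0// ltW.
have := @geometric_psum_le R (r * q) N rq0; rewrite rq mulrAC; lra.
Qed.

End Bohr.

Theorem theorem1p1 (R : realType) (d : nat) (d_ge1 : (1 <= d)%N) :
  1 / (Num.sqrt (d%:R : R) + 2) <= bohr_agler_radius R d /\
  exists2 r : R,
    unique (fun r : R => 0 < r /\
      (\sum_(1 <= k <oo) (r ^+ k * Num.sqrt ('C(d + k - 2, k - 1)%N%:R))%:E
         = (1 / 2 : R)%:E)%E) r &
    r <= bohr_agler_radius R d.
Proof.
case: d d_ge1 => // n _; split.
  apply: bohr_agler_radius_ge (psum_bohr_half _ _).
  have := sqrtr_ge0 (n.+1%:R : R); set q := Num.sqrt _ => q0.
  by rewrite divr_gt0 ?ltr_pdivrMr; lra.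
have half_lt : 1 / 2 < 3 / 4 :> R by lra.
have [r [r01 r_half [[r0 r_root] r_uniq]]] :=
  half_root (@bohr_coef_ge0 R n) (@bohr_coef0 R n) half_lt (@psum_bohr_bounded R n).
exists r; last exact: bohr_agler_radius_ge.
split=> [|s [s0 /(bohr_series_eq _ (ltW s0)) s_root]]; last exact: r_uniq.
by split=> //; apply/bohr_series_eq => //; exact: ltW.
Qed.
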